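(* Assume that for all integers $0\le M,N\le 2s$ there exist a non-trivial admissible solution $S_-^{M(h)}=\{u_1,\dots,u_M\}$ of $E_-^M(u_i,\bar u_i)=0$ ($i=1,\dots,M$) and a non-trivial admissible solution $S_+^{*N(h)}=\{w_1,\dots,w_N\}$ of $E_+^N(w_i,\bar w_i)=0$ ($i=1,\dots,N$). Then for all $0\le M,N\le 2s$: $$|\theta_M\rangle=\mathcal N_M(\bar u)\,|\Psi_-^M(\bar u,m_0)\rangle\quad\text{for }\bar u=S_-^{M(h)},\qquad |\theta^*_N\rangle=\mathcal N^*_N(\bar w)\,|\Psi_+^N(\bar w,m_0)\rangle\quad\text{for }\bar w=S_+^{*N(h)},$$ with $$\mathcal N_M(\bar u)=\prod_{k=1}^M\big(q\,u_k\,b(u_k^2)A^*_{k,k-1}\big)^{-1},\qquad \mathcal N^*_N(\bar w)=\prod_{k=1}^N\big(-q^{-1}w_k^{-1}b(w_k^2)A_{k,k-1}\big)^{-1},$$ and $\mathcal N_0=\mathcal N_0^*=1$.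
   Context: **Setting.** $q\in\mathbb C^*$ is not a root of unity; $[X,Y]_q=qXY-q^{-1}YX$; $b(x)=x-x^{-1}$. $s\ge 0$ is an integer or half-integer. $\mathsf b,\mathsf c,\mathsf b^*,\mathsf c^*,\zeta\in\mathbb C^*$ are generic subject to $\mathsf b\mathsf c=\mathsf b^*\mathsf c^*$ (in particular all quantities below are well defined). Put $\theta_M=\mathsf b q^{2M}+\mathsf c q^{-2M}$, $\theta^*_N=\mathsf b^*q^{2N}+\mathsf c^*q^{-2N}$, $\rho=-\mathsf b\mathsf c(q^2-q^{-2})^2$, $\omega=(q-q^{-1})^2\big(\mathsf b\mathsf c(\zeta^2+\zeta^{-2})(q^{2s+1}+q^{-2s-1})-(\mathsf b q^{2s}+\mathsf c q^{-2s})(\mathsf b^*q^{2s}+\mathsf c^*q^{-2s})\big)$, $\eta=-\frac{(q^2-q^{-2})^2}{q+q^{-1}}\mathsf b\mathsf c\big((\mathsf b q^{2s}+\mathsf c q^{-2s})(\zeta^2+\zeta^{-2})-(\mathsf b^*q^{2s}+\mathsf c^*q^{-2s})(q^{2s+1}+q^{-2s-1})\big)$, and $\eta^*$ is obtained from $\eta$ by exchanging $(\mathsf b,\mathsf c)\leftrightarrow(\mathsf b^*,\mathsf c^* )$. $\mathcal V$ is a complex vector space of dimension $2s+1$, and $A,A^*\in\mathrm{End}(\mathcal V)$ (the images $\pi(\mathsf A),\pi(\mathsf A^* )$ of the generators of the Askey-Wilson algebra) are diagonalizable, multiplicity-free, act irreducibly on $\mathcal V$, have eigenvalues $\{\theta_M\}_{M=0}^{2s}$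 and $\{\theta^*_N\}_{N=0}^{2s}$ respectively, and satisfy the Askey-Wilson relations $[A,[A,A^*]_q]_{q^{-1}}=\rho A^*+\omega A+\eta I$, $[A^*,[A^*,A]_q]_{q^{-1}}=\rho A+\omega A^*+\eta^*I$. They form a Leonard pair: there are eigenbases $A|\theta_M\rangle=\theta_M|\theta_M\rangle$, $A^*|\theta^*_N\rangle=\theta^*_N|\theta^*_N\rangle$ ($0\le M,N\le 2s$) with $A^*|\theta_M\rangle=A^*_{M+1,M}|\theta_{M+1}\rangle+A^*_{M,M}|\theta_M\rangle+A^*_{M-1,M}|\theta_{M-1}\rangle$ and $A|\theta^*_N\rangle=A_{N+1,N}|\theta^*_{N+1}\rangle+A_{N,N}|\theta^*_N\rangle+A_{N-1,N}|\theta^*_{N-1}\rangle$, normalized so that $|\theta^*_0\rangle=\sum_M|\theta_M\rangle$ and $$A^*_{M,M-1}=q^{2-4s}\frac{(1-q^{2M})(\mathsf c-\mathsf b q^{2M+4s})(\mathsf b^*q^{2s-1}\zeta^{-2}+\mathsf b q^{2M-2})(\mathsf c q^{2s-1}\zeta^2+\mathsf c^*q^{2M-2})}{(\mathsf c-\mathsf b q^{4M-2})(\mathsf c-\mathsf b q^{4M})},$$ $$A^*_{M-1,M}=\frac{(1-q^{2M-4s-2})(\mathsf c-\mathsf b q^{2M-2})(\mathsf c+\mathsf b^*\zeta^{-2}q^{2M+2s-1})(\mathsf c^*+\mathsf b\zeta^2q^{2M+2s-1})}{(\mathsf c-\mathsf b q^{4M-4})(\mathsf c-\mathsf b q^{4M-2})},$$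 $A^*_{M,M}=\theta^*_0-A^*_{M,M+1}-A^*_{M,M-1}$, the coefficients $A_{N,N'}$ being obtained by $(\mathsf b,\mathsf c,\zeta,M)\leftrightarrow(\mathsf b^*,\mathsf c^*,\zeta^{-1},N)$. The reference states are $|\Omega^-\rangle=|\theta_0\rangle$, $|\Omega^+\rangle=|\theta^*_0\rangle$. **Bethe states.** Fix $\chi\in\mathbb C^*$ and an integer $m_0$. Put $$\mathcal B(u)=\chi\,b(u^2)\Big(\rho^{-1}\big([A^*,A]_q+\tfrac{\omega}{q-q^{-1}}I\big)+\tfrac{qu^2+q^{-1}u^{-2}}{q^2-q^{-2}}I\Big).$$ - $|\Psi_-^M(\bar u,m_0)\rangle=\mathscr B^-(u_1,m_0+2(M-1))\cdots\mathscr B^-(u_M,m_0)|\Omega^-\rangle$, where $\mathscr B^-(u,m)=\alpha^{-1}q^{m+2}u\,\mathcal B(u)$ with $(q^2-q^{-2})\chi^{-1}\alpha\,\mathsf b\,q^{-m_0}=-1$. - $|\Psi_+^N(\bar w,m_0)\rangle=\mathscr B^+(w_1,m_0+2(N-1))\cdots\mathscr B^+(w_N,m_0)|\Omega^+\rangle$, where $\mathscr B^+(u,m)=\alpha^{-1}q^{-m-2}u^{-1}\mathcal B(u)$ with $(q^2-q^{-2})\chi^{-1}\alpha\,\mathsf c^*q^{m_0}=1$. **Homogeneous Bethe equations.** $f(u,v)=\frac{b(qv/u)b(uv)}{b(v/u)b(quv)}$, $h(u,v)=\frac{b(q^2uv)b(qu/v)}{b(quv)b(u/v)}$. For $\epsilon=\pm1$,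 $$\Lambda_1^\epsilon(u)=\tfrac{q^{-2s-1}}{u^\epsilon}(q^{2s+1}u\zeta^{-1}-u^{-1}\zeta)(q^{2s+1}u\zeta-u^{-1}\zeta^{-1})(u\mathsf c^*q^{-2s}+u^{-1}\mathsf b q^{2s})\Big(u(\tfrac{\mathsf c}{\mathsf c^*})^{\frac{1-\epsilon}2}+u^{-1}(\tfrac{\mathsf b^*}{\mathsf b})^{\frac{1+\epsilon}2}\Big),$$ $$\Lambda_2^\epsilon(u)=\tfrac{(u^2-u^{-2})q^{-2s-1}}{u^\epsilon(qu^2-q^{-1}u^{-2})}(q^{2s-1}u^{-1}\zeta-u\zeta^{-1})(q^{2s-1}u^{-1}\zeta^{-1}-u\zeta)(q^2u\mathsf b q^{2s}+u^{-1}\mathsf c^*q^{-2s})\Big(q^2u(\tfrac{\mathsf b^*}{\mathsf b})^{\frac{1+\epsilon}2}+u^{-1}(\tfrac{\mathsf c}{\mathsf c^*})^{\frac{1-\epsilon}2}\Big),$$ $$E_\pm^M(u_i,\bar u_i)=-\frac{b(u_i^2)}{b(qu_i^2)}\prod_{j\ne i}f(u_i,u_j)\Lambda_1^\pm(u_i)+\prod_{j\neq i}h(u_i,u_j)\Lambda_2^\pm(u_i),\quad 1\le i,j\le M.$$ A solution is *non-trivial* if $u_i\ne0$ and $u_i^2\neq u_i^{-2}$ for all $i$, and *admissible* if $U_i\ne U_j$ for $i\neq j$, where $U_i=(qu_i^2+q^{-1}u_i^{-2})/(q+q^{-1})$; the equations are understood where defined ($b(qu_i^2)\ne0$). *)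

(* Defs.v *)
From mathcomp Require Import all_boot all_order all_algebra.

Set Implicit Arguments.
Unset Strict Implicit.
Unset Printing Implicit Defensive.

Import GRing.Theory.
Local Open Scope ring_scope.

(* The spin s is an integer or a half-integer; it enters only through the
   natural number aw_2s = 2s, so that all powers of q are integer powers. *)
Record aw_params (F : Type) := AWParams {
  aw_2s : nat;
  aw_q : F;
  aw_b : F;
  aw_c : F;
  aw_bs : F;
  aw_cs : F;
  aw_zeta : F
}.

(* Exchange (b, c) <-> (b*, c* ). *)
Definition aw_swap (F : Type) (p : aw_params F) : aw_params F :=
  AWParams (aw_2s p) (aw_q p) (aw_bs p) (aw_cs p) (aw_b p) (aw_c p)
           (aw_zeta p).

(* Exchange (b, c, zeta) <-> (b*, c*, zeta^-1). *)
Definition aw_dual (F : fieldType) (p : aw_params F) : aw_params F :=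
  AWParams (aw_2s p) (aw_q p) (aw_bs p) (aw_cs p) (aw_b p) (aw_c p)
           (aw_zeta p)^-1.

Section Scalars.
Context {F : fieldType} (p : aw_params F).
Local Notation n := (aw_2s p).
Local Notation s2 := (Posz (aw_2s p)).
Local Notation q := (aw_q p).
Local Notation b := (aw_b p).
Local Notation c := (aw_c p).
Local Notation bs := (aw_bs p).
Local Notation cs := (aw_cs p).
Local Notation zeta := (aw_zeta p).

(* Genericity.  The factors c - b q^(2k), 0 <= k <= 4s, are the ones occurring
   in the denominators of A*_{M,M-1} and A*_{M-1,M} for 1 <= M <= 2s (and
   similarly for the starred parameters). *)
Definition aw_generic : Prop :=
  [/\ [/\ q != 0, b != 0 & c != 0],
      [/\ bs != 0, cs != 0 & zeta != 0],
      (forall k : nat, (0 < k)%N -> q ^+ k != 1),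
      b * c = bs * cs
    & forall k : nat, (k <= 2 * n)%N ->
        (c - b * q ^+ (2 * k) != 0) /\ (cs - bs * q ^+ (2 * k) != 0)].

Definition theta (M : nat) : F :=
  b * q ^ (2 * M%:Z) + c * q ^ (- (2 * M%:Z)).

Definition theta_star (N : nat) : F :=
  bs * q ^ (2 * N%:Z) + cs * q ^ (- (2 * N%:Z)).

Definition aw_rho : F := - (b * c) * (q ^ 2 - q ^ (-2)) ^+ 2.

Definition aw_omega : F :=
  (q - q^-1) ^+ 2 *
  (b * c * (zeta ^ 2 + zeta ^ (-2)) * (q ^ (s2 + 1) + q ^ (- s2 - 1))
   - (b * q ^ s2 + c * q ^ (- s2)) * (bs * q ^ s2 + cs * q ^ (- s2))).

Definition aw_eta : F :=
  - ((q ^ 2 - q ^ (-2)) ^+ 2 / (q + q^-1)) * (b * c) *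
  ((b * q ^ s2 + c * q ^ (- s2)) * (zeta ^ 2 + zeta ^ (-2))
   - (bs * q ^ s2 + cs * q ^ (- s2)) * (q ^ (s2 + 1) + q ^ (- s2 - 1))).

(* A*_{M,M-1} *)
Definition Astar_up (M : nat) : F :=
  q ^ (2 - 2 * s2) *
  ((1 - q ^ (2 * M%:Z)) * (c - b * q ^ (2 * M%:Z + 2 * s2))
   * (bs * q ^ (s2 - 1) * zeta ^ (-2) + b * q ^ (2 * M%:Z - 2))
   * (c * q ^ (s2 - 1) * zeta ^ 2 + cs * q ^ (2 * M%:Z - 2)))
  / ((c - b * q ^ (4 * M%:Z - 2)) * (c - b * q ^ (4 * M%:Z))).

(* A*_{M-1,M} *)
Definition Astar_down (M : nat) : F :=
  ((1 - q ^ (2 * M%:Z - 2 * s2 - 2)) * (c - b * q ^ (2 * M%:Z - 2))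
   * (c + bs * zeta ^ (-2) * q ^ (2 * M%:Z + s2 - 1))
   * (cs + b * zeta ^ 2 * q ^ (2 * M%:Z + s2 - 1)))
  / ((c - b * q ^ (4 * M%:Z - 4)) * (c - b * q ^ (4 * M%:Z - 2))).

(* A*_{L,M}.  The diagonal entry uses A*_{0,-1} = 0 and A*_{2s,2s+1} = 0, which
   the formulas give because of the factors 1 - q^0. *)
Definition Astar_coef (L M : nat) : F :=
  if L == M.+1 then Astar_up L
  else if L == M then theta_star 0 - Astar_down M.+1 - Astar_up M
  else if M == L.+1 then Astar_down M
  else 0.

Definition b_fun (x : F) : F := x - x^-1.

Definition f_fun (u v : F) : F :=
  (b_fun (q * v / u) * b_fun (u * v)) / (b_fun (v / u) * b_fun (q * u * v)).

Definition h_fun (u v : F) : F :=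
  (b_fun (q ^+ 2 * u * v) * b_fun (q * u / v))
  / (b_fun (q * u * v) * b_fun (u / v)).

(* eps is 1 or -1, so (1 - eps) / 2 and (1 + eps) / 2 are 0 or 1. *)
Definition Lambda1 (eps : int) (u : F) : F :=
  q ^ (- s2 - 1) / u ^ eps
  * (q ^ (s2 + 1) * u * zeta^-1 - u^-1 * zeta)
  * (q ^ (s2 + 1) * u * zeta - u^-1 * zeta^-1)
  * (u * cs * q ^ (- s2) + u^-1 * b * q ^ s2)
  * (u * (c / cs) ^ ((1 - eps) %/ 2)%Z + u^-1 * (bs / b) ^ ((1 + eps) %/ 2)%Z).

Definition Lambda2 (eps : int) (u : F) : F :=
  (u ^ 2 - u ^ (-2)) * q ^ (- s2 - 1)
  / (u ^ eps * (q * u ^ 2 - q^-1 * u ^ (-2)))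
  * (q ^ (s2 - 1) * u^-1 * zeta - u * zeta^-1)
  * (q ^ (s2 - 1) * u^-1 * zeta^-1 - u * zeta)
  * (q ^ 2 * u * b * q ^ s2 + u^-1 * cs * q ^ (- s2))
  * (q ^ 2 * u * (bs / b) ^ ((1 + eps) %/ 2)%Z
     + u^-1 * (c / cs) ^ ((1 - eps) %/ 2)%Z).

Section BetheEquations.
Context {M : nat} (eps : int) (u : 'I_M -> F).

Definition bethe_E (i : 'I_M) : F :=
  - (b_fun (u i ^ 2) / b_fun (q * u i ^ 2))
    * (\prod_(j < M | j != i) f_fun (u i) (u j)) * Lambda1 eps (u i)
  + (\prod_(j < M | j != i) h_fun (u i) (u j)) * Lambda2 eps (u i).

Definition bethe_nontrivial : Prop :=
  forall i : 'I_M, u i != 0 /\ u i ^ 2 != u i ^ (-2).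

Definition bethe_U (i : 'I_M) : F :=
  (q * u i ^ 2 + q^-1 * u i ^ (-2)) / (q + q^-1).

Definition bethe_admissible : Prop :=
  forall i j : 'I_M, i != j -> bethe_U i != bethe_U j.

(* The equations are defined: for nonzero u_i with pairwise distinct U_i the
   other denominators, b(u_j/u_i) and b(q u_i u_j), do not vanish, because
   U_i = U_j iff u_i^2 = u_j^2 or q^2 u_i^2 u_j^2 = 1. *)
Definition bethe_defined : Prop :=
  forall i : 'I_M, b_fun (q * u i ^ 2) != 0.

Definition bethe_solution : Prop :=
  [/\ bethe_nontrivial, bethe_admissible, bethe_defined
    & forall i : 'I_M, bethe_E i = 0].

End BetheEquations.

End Scalars.

(* Indices of u start at 0 here: u_k of the text is u (k - 1). *)

Definition norm_minus {F : fieldType} (p : aw_params F) (M : nat)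
    (u : 'I_M -> F) : F :=
  \prod_(k < M)
    (aw_q p * u k * b_fun (u k ^ 2) * Astar_coef p k.+1 k)^-1.

Definition norm_plus {F : fieldType} (p : aw_params F) (N : nat)
    (w : 'I_N -> F) : F :=
  \prod_(k < N)
    (- (aw_q p)^-1 * (w k)^-1 * b_fun (w k ^ 2)
       * Astar_coef (aw_dual p) k.+1 k)^-1.

Section Operators.
Context {F : fieldType} (p : aw_params F) {V : vectType F} (A As : 'End(V)).
Local Notation n := (aw_2s p).
Local Notation q := (aw_q p).

(* [X, Y]_r = r X Y - r^-1 Y X *)
Definition qcomm (r : F) (X Y : 'End(V)) : 'End(V) :=
  r *: (X \o Y)%VF - r^-1 *: (Y \o X)%VF.

Definition aw_relations : Prop :=
  qcomm q^-1 A (qcomm q A As)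
    = aw_rho p *: As + aw_omega p *: A + aw_eta p *: \1%VF
  /\
  qcomm q^-1 As (qcomm q As A)
    = aw_rho p *: A + aw_omega p *: As + aw_eta (aw_swap p) *: \1%VF.

Definition irreducible_action : Prop :=
  forall U : {vspace V},
    (A @: U <= U)%VS -> (As @: U <= U)%VS -> U = 0%VS \/ U = fullv.

Definition multfree_eigenbasis (X : 'End(V)) (ev : nat -> F)
    (e : 'I_n.+1 -> V) : Prop :=
  [/\ basis_of fullv (codom e),
      injective (fun M : 'I_n.+1 => ev M)
    & forall M, X (e M) = ev M *: e M].

Record aw_leonard_pair (ket kets : 'I_n.+1 -> V) : Prop := AWLeonardPair {
  lp_dim : \dim (fullv : {vspace V}) = n.+1;
  lp_ket : multfree_eigenbasis A (theta p) ket;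
  lp_kets : multfree_eigenbasis As (theta_star p) kets;
  lp_irreducible : irreducible_action;
  lp_relations : aw_relations;
  lp_As_ket : forall M, As (ket M) = \sum_(L < n.+1) Astar_coef p L M *: ket L;
  lp_A_kets : forall N,
    A (kets N) = \sum_(L < n.+1) Astar_coef (aw_dual p) L N *: kets L;
  lp_normalization : kets ord0 = \sum_(M < n.+1) ket M
}.

Definition calB (chi u : F) : 'End(V) :=
  (chi * b_fun (u ^ 2)) *:
  ((aw_rho p)^-1 *: (qcomm q As A + (aw_omega p / (q - q^-1)) *: \1%VF)
   + ((q * u ^ 2 + q^-1 * u ^ (-2)) / (q ^ 2 - q ^ (-2))) *: \1%VF).

Definition scrB_minus (chi alpha u : F) (m : int) : 'End(V) :=
  (alpha^-1 * q ^ (m + 2) * u) *: calB chi u.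

Definition scrB_plus (chi alpha u : F) (m : int) : 'End(V) :=
  (alpha^-1 * q ^ (- m - 2) * u^-1) *: calB chi u.

(* B(u_1, m0 + 2(M-1)) ... B(u_M, m0) Omega: the last factor acts first, and
   the factor with 0-based index i carries m0 + 2(M - 1 - i). *)
Definition bethe_vector (B : F -> int -> 'End(V)) (Omega : V) (m0 : int)
    (M : nat) (u : 'I_M -> F) : V :=
  foldr (fun (i : 'I_M) (v : V) =>
           B (u i) (m0 + 2 * (M%:Z - 1 - (nat_of_ord i)%:Z)) v)
        Omega (enum 'I_M).

End Operators.

Arguments aw_leonard_pair {F} p {V} A As ket kets.

(* Main.v *)
(** Up to scalars, every B(u) is Z + g(u) with g(u) = (q u^2 + q^-1 u^-2)/(q^2 - q^-2)
    and the single operator Z = rho^-1 ([A*, A]_q + omega/(q - q^-1)), so a Bethe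
    state is r(Z)|theta_0> with r the monic polynomial of roots -g(u_i).

    The Askey-Wilson relations give
    Z^2 A - (q^2 + q^-2) Z A Z + A Z^2 = - A + k1 Z + k0; together with the action on
    |theta_0> and Z|theta_0> this determines an operator L on polynomials with
    A r(Z)|theta_0> = (L r)(Z)|theta_0>.  L is upper triangular on monomials with
    diagonal theta_k, and in the variable z = -g(u) it is a second-order q-difference
    operator with shifts u -> q^-1 u and u -> q u, whose coefficients are, up to a
    common factor, those of the homogeneous Bethe equations.  Hence these equations say
    exactly that L r vanishes at the roots of r, so L r - theta_M r has degree < M and
    M distinct roots: L r = theta_M r, and r(Z)|theta_0> is an eigenvector of A.  As Z
    is tridiagonal on the |theta_M>, the factor is the product of its subdiagonal
    entries, which are nonzero by irreducibility.

    The statement for A* is the one for A after the symmetry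
    (q, b, c, b*, c*, zeta, u) -> (q^-1, c*, b*, c, b, zeta^-1, u^-1), A <-> A*,
    which maps Z to - Z and fixes B(u). *)

Require Import Defs.
From HB Require Import structures.
From mathcomp Require Import all_boot all_order all_algebra.
From mathcomp Require Import complex reals.
From mathcomp Require Import ring.

Set Implicit Arguments.
Unset Strict Implicit.
Unset Printing Implicit Defensive.

Import GRing.Theory.
Local Open Scope ring_scope.

(** * Vector identities tested on linear forms, where [field] applies *)

Lemma scalar_ext (F : fieldType) (V : vectType F) (x y : V) :
  (forall f : {scalar V}, f x = f y) -> x = y.
Proof.
move=> fxy.
rewrite (coord_vbasis (memvf x)) (coord_vbasis (memvf y)).
by apply: eq_bigr => i _; rewrite fxy.
Qed.

Lemma scalarE {F : fieldType} {V : vectType F} (f : {scalar V}) :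
  (forall x y, f (x + y) = f x + f y) * (forall a x, f (a *: x) = a * f x)
  * (forall x, f (- x) = - f x).
Proof. by split; [split|]; move=> *; rewrite ?linearD ?linearZ ?linearN. Qed.

Lemma lfun_linearE {F : fieldType} {V : vectType F} (X : 'End(V)) :
  (forall x y, X (x + y) = X x + X y) * (forall a x, X (a *: x) = a *: X x)
  * (forall x, X (- x) = - X x).
Proof. by split; [split|]; move=> *; rewrite ?linearD ?linearZ ?linearN. Qed.

(** * The third generator *)

Section ThirdGenerator.
Context {F : fieldType} (p : aw_params F) {V : vectType F} (A As : 'End(V)).
Local Notation q := (aw_q p).

Definition aw_third : 'End(V) :=
  (aw_rho p)^-1 *: (qcomm q As A + (aw_omega p / (q - q^-1)) *: \1%VF).

(* Eliminate A* between the two Askey-Wilson relations, each of which is linear in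
   A* once written with X = [A*, A]_q; passing to Z = rho^-1 (X + omega/(q - q^-1))
   removes the terms X A + A X. *)
Lemma aw_third_relation (v : V) :
  q != 0 -> q ^+ 2 - 1 != 0 -> aw_rho p != 0 -> aw_relations p A As ->
  aw_third (aw_third (A v)) - (q ^+ 2 + (q ^+ 2)^-1) *: aw_third (A (aw_third v))
    + A (aw_third (aw_third v))
  = - A v + ((q - q^-1) * aw_eta p / aw_rho p) *: aw_third v
    - (aw_eta (aw_swap p) / aw_rho p) *: v.
Proof.
move=> q0 q21 rho0 [/lfunP R1 /lfunP R2].
have lE := (comp_lfunE, add_lfunE, scale_lfunE, opp_lfunE, id_lfunE).
pose X := qcomm q As A.
have XE w : X w = q *: As (A w) - q^-1 *: A (As w) by rewrite /X /qcomm !lE.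
have ZE w : aw_third w = (aw_rho p)^-1 *: (X w + (aw_omega p / (q - q^-1)) *: w).
  by rewrite /aw_third -/X !lE.
clearbody X.
(* The double bracket is symmetric: [A, [A, A*]_q]_r = [[A*, A]_q, A]_r for r = q^-1. Hence both
   relations can be written with [X] as the only inner bracket. *)
have R1' w : q^-1 *: X (A w) - q *: A (X w) = aw_rho p *: As w + aw_omega p *: A w + aw_eta p *: w.
  move: (R1 w); rewrite /qcomm !lE => <-; rewrite !XE.
  apply: scalar_ext => g.
  rewrite !(lfun_linearE, scalarE).
  by field; rewrite q0 oner_neq0.
have R2' w : q^-1 *: As (X w) - q *: X (As w)
    = aw_rho p *: A w + aw_omega p *: As w + aw_eta (aw_swap p) *: w.
  move: (R2 w); rewrite /qcomm !lE => <-; rewrite !XE.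
  apply: scalar_ext => g.
  rewrite !(lfun_linearE, scalarE).
  by field; rewrite q0 oner_neq0.
apply: scalar_ext => f.
have D0 (x y : V) : x = y -> f x - f y = 0 by move->; rewrite subrr.
have := D0 _ _ (R1' v).
have := D0 _ _ (R2' v).
have := D0 _ _ (R1' (X v)).
have := D0 _ _ (congr1 X (R1' v)).
rewrite !ZE !(lfun_linearE, scalarE).
set D1 := (D in D = 0 -> _) => D10.
set D2 := (D in D = 0 -> _) => D20.
set D3 := (D in D = 0 -> _) => D30.
set D4 := (D in D = 0 -> _) => D40.
apply/eqP; rewrite -subr_eq0; apply/eqP.
(* [q * D1 - q^-1 * D2] produces the terms quadratic in [X]; [D3] cancels the products of [X] and
   [As] that come along, and [D4] the remaining [As]. *)
transitivity ((aw_rho p) ^- 2 * (- (q^-1 * D2 - q * D1) - aw_rho p * D3 + aw_omega p * D4)).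
  rewrite /D1 /D2 /D3 /D4.
  by field; rewrite q0 rho0 -expr2 q21.
by rewrite D10 D20 D30 D40 !(mulr0, subr0, addr0, oppr0).
Qed.

End ThirdGenerator.

(** * The operator L on polynomials *)

Section MonomialExtension.
Context {F : fieldType} {W : lmodType F} (g : nat -> W).

(** Serves twice: with the iterates of Z on a vector it evaluates polynomials at Z, and with
    prescribed images of monomials it defines L. *)
Definition monext (p : {poly F}) : W := \sum_(i < size p) p`_i *: g i.

Lemma monext_widen (m : nat) (p : {poly F}) :
  (size p <= m)%N -> monext p = \sum_(i < m) p`_i *: g i.
Proof.
move=> le_pm; rewrite /monext (big_ord_widen _ (fun i => p`_i *: g i) le_pm).
rewrite big_mkcond; apply: eq_bigr => i _; case: ltnP => // /(nth_default 0) ->.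
by rewrite scale0r.
Qed.

Lemma monext_is_linear : linear monext.
Proof.
move=> a p r; pose m := maxn (size p) (size r).
have le_m : (size (a *: p + r)%R <= m)%N.
  rewrite (leq_trans (size_polyD _ _)) // geq_max leq_maxr.
  by rewrite (leq_trans (size_scale_leq _ _)) // leq_maxl.
rewrite (monext_widen le_m) (monext_widen (leq_maxl _ _ : size p <= m)%N).
rewrite (monext_widen (leq_maxr _ _ : size r <= m)%N) scaler_sumr -big_split.
by apply: eq_bigr => i _; rewrite coefD coefZ scalerDl scalerA.
Qed.

HB.instance Definition _ :=
  GRing.isLinear.Build F {poly F} W *:%R monext monext_is_linear.

Lemma monextXn (k : nat) : monext 'X^k = g k.
Proof.
rewrite (monext_widen (eq_leq (size_polyXn F k))) (bigD1 ord_max) //= big1.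
  by rewrite coefXn eqxx scale1r addr0.
by move=> i ne_ik; rewrite coefXn -val_eqE /= in ne_ik *; rewrite (negPf ne_ik) scale0r.
Qed.

Lemma monextZ (a : F) (p : {poly F}) : monext (a *: p) = a *: monext p.
Proof. exact: linearZ. Qed.

End MonomialExtension.

Section CyclicModule.
Context {F : fieldType} {V : vectType F} (Z : 'End(V)) (v : V).

Definition orbit_poly : {poly F} -> V := monext (fun k => iter k Z v).

HB.instance Definition _ := GRing.Linear.on orbit_poly.

Lemma orbit_polyZ (a : F) (r : {poly F}) : orbit_poly (a *: r) = a *: orbit_poly r.
Proof. exact: linearZ. Qed.

Lemma orbit_polyXn (k : nat) : orbit_poly 'X^k = iter k Z v.
Proof. exact: monextXn. Qed.

Lemma orbit_poly1 : orbit_poly 1 = v.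
Proof. by rewrite -(expr0 'X) /orbit_poly monextXn. Qed.

Lemma orbit_polyXM (r : {poly F}) : orbit_poly ('X * r) = Z (orbit_poly r).
Proof.
rewrite -[r]coefK poly_def mulr_sumr /orbit_poly.
rewrite !(linear_sum (monext _)) (linear_sum Z) /=; apply: eq_bigr => i _.
by rewrite -scalerAr -exprS !monextZ linearZ /= !monextXn.
Qed.

End CyclicModule.

Section DifferenceOperator.
Context {F : fieldType} (th : nat -> F) (b1 be k1 k0 : F).

(* [aw_op_mon k] is L X^k: the recursion is the relation between A and Z, solved for
   A Z^(k+2). *)
Fixpoint aw_op_mon (k : nat) : {poly F} :=
  if k is k'.+1 then
    if k' is k''.+1 then
      be *: ('X * aw_op_mon k') - ('X ^+ 2 + 1) * aw_op_mon k''
        + k1 *: 'X^k' + k0 *: 'X^k''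
    else th 1%N *: 'X + b1%:P
  else (th 0)%:P.

Definition aw_op : {poly F} -> {poly F} := monext aw_op_mon.

Lemma aw_op_monSS (k : nat) :
  aw_op_mon k.+2 = be *: ('X * aw_op_mon k.+1) - ('X ^+ 2 + 1) * aw_op_mon k
        + k1 *: 'X^(k.+1) + k0 *: 'X^k.
Proof. by []. Qed.

Lemma nat_ind2 (P : nat -> Prop) :
  P 0 -> P 1 -> (forall k, P k -> P k.+1 -> P k.+2) -> forall k, P k.
Proof.
move=> P0 P1 PS k; suff: P k /\ P k.+1 by case.
by elim: k => [|k [? ?]]; split; auto.
Qed.

(** Only the first two terms of the recursion reach degree k+2, and there they reproduce the
    recurrence of [th]; this is the triangularity of L. *)
Lemma aw_op_mon_coef (k j : nat) :
  (forall m, th m.+2 = be * th m.+1 - th m) ->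
  (k <= j)%N -> (aw_op_mon k)`_j = th k *+ (j == k).
Proof.
move=> thSS; elim/nat_ind2: k j => [|| k IH IH1] j le_kj.
- by rewrite coefC; case: j le_kj.
- by rewrite coefD coefZ coefX coefC; case: j le_kj => [|[|j]] //= _; rewrite ?mulr1 ?mulr0 ?addr0.
case: j le_kj => [|[|j]] // le_kj.
rewrite aw_op_monSS !coefD coefN !coefZ mulrDl mul1r coefD !coefXn coefXM coefXnM /=.
have le_kj2 : (k <= j.+2)%N by exact: ltnW (ltnW le_kj).
rewrite !subSS subn0 (IH _ le_kj) (IH _ le_kj2) (IH1 j.+1 le_kj) !eqSS.
have lt_k1 : (k < j.+1)%N by [].
have lt_k2 : (k < j.+2)%N by exact: leqW.
rewrite (gtn_eqF lt_k1) (gtn_eqF lt_k2) thSS.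
by case: eqP => _ /=; ring.
Qed.

Lemma aw_op_monic_size (p : {poly F}) :
  (forall m, th m.+2 = be * th m.+1 - th m) ->
  p \is monic -> (size (aw_op p - th (size p).-1 *: p)%R <= (size p).-1)%N.
Proof.
move=> thSS p_monic; apply/leq_sizeP => j le_j.
have [m sz_p] : exists m, size p = m.+1.
  by exists (size p).-1; rewrite prednK // size_poly_gt0 monic_neq0.
rewrite sz_p /= in le_j *.
rewrite coefB coefZ /aw_op /monext sz_p coef_sum big_ord_recr /= big1 => [|i _]; last first.
  by rewrite coefZ aw_op_mon_coef ?(gtn_eqF (leq_trans (ltn_ord i) le_j)) ?mulr0 // ltnW ?(leq_trans _ le_j).
rewrite add0r coefZ aw_op_mon_coef //; case: eqVneq => [->|ne_jm].
  by rewrite mulrC subrr.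
by rewrite mulr0 nth_default ?mulr0 ?subr0 // sz_p ltn_neqAle eq_sym ne_jm.
Qed.

(* L is a difference operator at any z whose shifts zm, zp are the two roots x of
   x^2 - be z x + z^2 + 1 = 0.  Only multiples of X - z are evaluated, so that the
   coefficients fm, fp stay defined when zp = z. *)
Lemma aw_op_factor (z zm zp fm fp : F) (r : {poly F}) :
  (zm ^+ 2 = be * z * zm - z ^+ 2 - 1) -> (zp ^+ 2 = be * z * zp - z ^+ 2 - 1) ->
  fm + fp = th 1%N * z + b1 - z * th 0%N ->
  fm * zm + fp * zp
    = (be - 1) * z * (th 1%N * z + b1) - (z ^+ 2 + 1) * th 0%N + k1 * z + k0 ->
  (aw_op (('X - z%:P) * r)).[z] = fm * r.[zm] + fp * r.[zp].
Proof.
move=> zm2 zp2 fsum fshift.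
have monSS m : (aw_op_mon m.+2).[z] = be * z * (aw_op_mon m.+1).[z]
    - (z ^+ 2 + 1) * (aw_op_mon m).[z] + k1 * (z * z ^+ m) + k0 * z ^+ m.
  rewrite aw_op_monSS; move: (aw_op_mon m.+1) (aw_op_mon m) => L1 L0.
  by rewrite -polyC1 !(hornerD, hornerN, hornerZ, hornerM, hornerX, hornerXn, hornerC) exprS; ring.
(* both sides satisfy x_(k+2) = be z x_(k+1) - (z^2 + 1) x_k *)
have key k : (aw_op_mon k.+1).[z] - z * (aw_op_mon k).[z] = fm * zm ^+ k + fp * zp ^+ k.
  elim/nat_ind2: k => [||k IH IH1].
  - by rewrite !expr0 !mulr1 fsum /= !hornerE.
  - rewrite !expr1 fshift /= !hornerE /=; ring.
  transitivity (be * z * (fm * zm ^+ k.+1 + fp * zp ^+ k.+1) - (z ^+ 2 + 1) * (fm * zm ^+ k + fp * zp ^+ k)).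
    rewrite -IH -IH1 !monSS !exprS; ring.
  rewrite !exprS; ring: zm2 zp2.
rewrite -[r]coefK poly_def mulr_sumr /aw_op linear_sum !horner_sum !mulr_sumr -big_split.
apply: eq_bigr => i _; rewrite -scalerAr linearZ /= mulrBl -exprS linearB mul_polyC linearZ /= !monextXn.
by rewrite !hornerE key /=; ring.
Qed.

Lemma orbit_poly_aw_op {V : vectType F} (A Z : 'End(V)) (v : V) (r : {poly F}) :
  A v = th 0%N *: v -> A (Z v) = th 1%N *: Z v + b1 *: v ->
  (forall w, Z (Z (A w)) - be *: Z (A (Z w)) + A (Z (Z w)) = - A w + k1 *: Z w + k0 *: w) ->
  A (orbit_poly Z v r) = orbit_poly Z v (aw_op r).
Proof.
move=> A0 A1 AZ.
have key k : A (iter k Z v) = orbit_poly Z v (aw_op_mon k).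
  elim/nat_ind2: k => [||k IH IH1].
  - by rewrite /= A0 -[th 0%N]mulr1 -scale_polyC polyC1 orbit_polyZ orbit_poly1 mulr1.
  - rewrite /= A1 linearD /= orbit_polyZ -(expr1 'X) orbit_polyXn.
    by rewrite -[b1 in RHS]mulr1 -scale_polyC polyC1 orbit_polyZ orbit_poly1.
  rewrite aw_op_monSS mulrDl mul1r expr2 -mulrA.
  rewrite !(linearD, linearN) /= !orbit_polyZ !orbit_polyXn !orbit_polyXM -IH -IH1.
  have /= := AZ (iter k Z v).
  move=> /(canRL (addKr _)) ->.
  by rewrite opprB !addrA.
rewrite -[r]coefK poly_def /aw_op.
rewrite (linear_sum (monext aw_op_mon)) !(linear_sum (orbit_poly _ _)) (linear_sum A) /=.
by apply: eq_bigr => i _; rewrite monextZ !orbit_polyZ linearZ /= monextXn orbit_polyXn key.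
Qed.

(** By [aw_op_factor] with the i-th linear factor split off, the last hypothesis says that L r
    vanishes at [z i]; injectivity of [z] makes these M distinct roots. *)
Lemma aw_op_prod (M : nat) (z zm zp fm fp : 'I_M -> F) :
  (forall m, th m.+2 = be * th m.+1 - th m) ->
  injective z ->
  (forall i, zm i ^+ 2 = be * z i * zm i - z i ^+ 2 - 1) ->
  (forall i, zp i ^+ 2 = be * z i * zp i - z i ^+ 2 - 1) ->
  (forall i, fm i + fp i = th 1%N * z i + b1 - z i * th 0%N) ->
  (forall i, fm i * zm i + fp i * zp i
    = (be - 1) * z i * (th 1%N * z i + b1) - (z i ^+ 2 + 1) * th 0%N + k1 * z i + k0) ->
  (forall i, fm i * \prod_(j < M | j != i) (zm i - z j)
           + fp i * \prod_(j < M | j != i) (zp i - z j) = 0) ->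
  let r := \prod_(j < M) ('X - (z j)%:P) in aw_op r = th M *: r.
Proof.
move=> thSS z_inj zm2 zp2 fsum fshift BE r; apply/eqP; rewrite -subr_eq0; apply/eqP.
have sz_r : size r = M.+1 by rewrite size_prod_XsubC /index_enum unlock -enumT size_enum_ord.
apply: (@roots_geq_poly_eq0 _ _ (codom z)).
- apply/allP => _ /codomP[i ->]; apply/rootP.
  rewrite hornerD hornerN hornerZ /r (bigD1 i) //= (aw_op_factor _ (zm2 i) (zp2 i) (fsum i) (fshift i)).
  rewrite hornerM hornerXsubC subrr mul0r mulr0 subr0 -[RHS](BE i) !horner_prod.
  by congr (_ * _ + _ * _); apply: eq_bigr => j _; rewrite hornerXsubC.
- by rewrite map_inj_uniq ?enum_uniq.
rewrite size_codom card_ord.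
by have := aw_op_monic_size thSS (monic_prod_XsubC _ _ _ : r \is monic); rewrite sz_r.
Qed.

End DifferenceOperator.

Lemma foldr_orbit_poly {F : fieldType} {V : vectType F} (Z : 'End(V)) (v : V)
    (I : Type) (s z : I -> F) (l : seq I) :
  foldr (fun i w => s i *: (Z w - z i *: w)) v l
    = (\prod_(i <- l) s i) *: orbit_poly Z v (\prod_(i <- l) ('X - (z i)%:P)).
Proof.
elim: l => [|i l IH]; first by rewrite !big_nil scale1r orbit_poly1.
rewrite /= !big_cons IH linearZ /= scalerA [z i * _]mulrC -[X in _ - X]scalerA -scalerBr scalerA.
congr (_ *: _).
by rewrite mulrBl mul_polyC linearB /= orbit_polyZ orbit_polyXM.
Qed.

(** * The Leonard basis *)

Section Generic.
Context {F : fieldType} (p : aw_params F).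
Local Notation n := (aw_2s p).
Local Notation q := (aw_q p).
Local Notation b := (aw_b p).
Local Notation c := (aw_c p).
Hypothesis hgen : aw_generic p.

Lemma generic_q : [/\ q != 0, q ^+ 2 - 1 != 0 & q ^+ 2 + 1 != 0].
Proof.
have [[q0 _ _] _ q_pow _ _] := hgen; split=> //; first by rewrite subr_eq0 q_pow.
apply: contraNneq (q_pow 4 isT) => q21.
by apply/eqP; transitivity ((q ^+ 2 + 1) * (q ^+ 2 - 1) + 1); [ring | rewrite q21 mul0r add0r].
Qed.

Lemma aw_rho_neq0 : aw_rho p != 0.
Proof.
have [q0 qm qp] := generic_q; have [[_ b0 c0] _ _ _ _] := hgen.
rewrite /aw_rho; apply: mulf_neq0; first by rewrite oppr_eq0 mulf_neq0.
apply: expf_neq0.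
have -> : q ^ 2 - q ^ (-2) = (q ^+ 2 - 1) * (q ^+ 2 + 1) / q ^+ 2.
  by rewrite -exprnN; field.
by rewrite !mulf_neq0 ?invr_eq0 ?expf_neq0.
Qed.

Lemma thetaE (M : nat) : theta p M = b * (q ^+ M) ^+ 2 + c / (q ^+ M) ^+ 2.
Proof. by rewrite /theta -invr_expz [2 * M%:Z]mulrC -exprz_exp. Qed.

Lemma theta_rec (M : nat) :
  theta p M.+2 = (q ^+ 2 + (q ^+ 2)^-1) * theta p M.+1 - theta p M.
Proof.
have [q0 _ _] := generic_q; have qM0 : q ^+ M != 0 by rewrite expf_neq0.
by rewrite !thetaE !exprS; field; rewrite ?q0 ?qM0.
Qed.

(** This factor multiplies A*_{M+1,M} in the subdiagonal of Z. The b terms cancel, which leaves a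
    constant times one power of q. *)
Lemma q_theta_sub_theta_succ (M : nat) :
  q * theta p M - q^-1 * theta p M.+1
    = c * (q ^ 2 - q ^ (-2)) / (q * (q ^+ 2) ^+ M).
Proof.
have [q0 _ _] := generic_q; have qM0 : q ^+ M != 0 by rewrite expf_neq0.
by rewrite !thetaE -exprnN [in RHS]exprAC !exprS; field; rewrite ?q0 ?qM0.
Qed.

Lemma Astar_up0 : Astar_up p 0 = 0.
Proof. by rewrite /Astar_up mulr0 expr0z subrr !mul0r mulr0 mul0r. Qed.

Lemma Astar_down1 : Astar_down p 1 =
  (1 - (q ^+ n) ^- 2) * (c - b) * (c + aw_bs p / aw_zeta p ^+ 2 * (q * q ^+ n))
   * (aw_cs p + b * aw_zeta p ^+ 2 * (q * q ^+ n)) / ((c - b) * (c - b * q ^+ 2)).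
Proof.
have [q0 _ _] := generic_q.
have e1 : q ^ (2 * 1%:Z - 2 * n%:Z - 2) = (q ^+ n) ^- 2.
  by rewrite mulr1 addrAC subrr sub0r -invr_expz mulrC -exprz_exp.
have e2 : q ^ (2 * 1%:Z + n%:Z - 1) = q * q ^+ n.
  by rewrite addrAC expfzDr.
by rewrite /Astar_down e1 e2 !mulr1.
Qed.

End Generic.

Section LeonardBasis.
Context {F : fieldType} (p : aw_params F) {V : vectType F} (A As : 'End(V)).
Context (ket : 'I_(aw_2s p).+1 -> V).
Local Notation n := (aw_2s p).
Local Notation q := (aw_q p).
Hypothesis hket : multfree_eigenbasis A (theta p) ket.
Hypothesis hAs : forall M, As (ket M) = \sum_(L < n.+1) Astar_coef p L M *: ket L.

Definition ket_coord (i : 'I_n.+1) : {scalar V} := coord [tuple ket i | i < n.+1] i.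

Lemma ket_coordE (i j : 'I_n.+1) : ket_coord i (ket j) = (j == i)%:R.
Proof.
have [/andP[_ free_ket] _ _] := hket.
rewrite -(coord_free j i (free_ket : free [tuple ket i | i < n.+1])).
by rewrite -tnth_nth tnth_mktuple.
Qed.

Lemma ket_coordZ (i : 'I_n.+1) (a : F) (w : V) : ket_coord i (a *: w) = a * ket_coord i w.
Proof. exact: linearZ. Qed.

Lemma ket_decomp (w : V) : w = \sum_i ket_coord i w *: ket i.
Proof.
have [basis_ket _ _] := hket.
rewrite {1}(coord_basis (basis_ket : basis_of fullv [tuple ket i | i < n.+1]) (memvf w)).
by apply: eq_bigr => i _; rewrite -tnth_nth tnth_mktuple.
Qed.

Lemma ket_coord_tridiag (T : 'End(V)) (t : nat -> nat -> F) :
  (forall M, T (ket M) = \sum_(L < n.+1) t L M *: ket L) ->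
  forall i w, ket_coord i (T w) = \sum_M ket_coord M w * t i M.
Proof.
move=> Tket i w; rewrite [in LHS](ket_decomp w) linear_sum (linear_sum (ket_coord i)).
apply: eq_bigr => M _; rewrite linearZ /= ket_coordZ Tket linear_sum /= (bigD1 i) //= big1.
  by rewrite addr0 ket_coordZ ket_coordE eqxx mulr1.
by move=> j /negPf ne_ji; rewrite ket_coordZ ket_coordE ne_ji mulr0.
Qed.

Lemma ket_coord_A (i : 'I_n.+1) (w : V) : ket_coord i (A w) = theta p i * ket_coord i w.
Proof.
have [_ _ Aket] := hket.
rewrite [in LHS](ket_decomp w) linear_sum (linear_sum (ket_coord i)) /= (bigD1 i) //= big1.
  by rewrite addr0 linearZ /= Aket !ket_coordZ ket_coordE eqxx mulr1 mulrC.
by move=> j /negPf ne_ji; rewrite linearZ /= Aket !ket_coordZ ket_coordE ne_ji !mulr0.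
Qed.

(** Distinct eigenvalues kill all coordinates of [w] but one; that one is the normalization still to
    be computed. *)
Lemma eigenvector_ket (M : 'I_n.+1) (w : V) :
  A w = theta p M *: w -> w = ket_coord M w *: ket M.
Proof.
have [_ theta_inj _] := hket => Aw.
rewrite [LHS]ket_decomp (bigD1 M) //= big1 ?addr0 // => j ne_jM.
have /eqP := ket_coord_A j w; rewrite Aw ket_coordZ -subr_eq0 -mulrBl mulf_eq0 subr_eq0.
by rewrite (inj_eq theta_inj) eq_sym (negPf ne_jM) /= => /eqP ->; rewrite scale0r.
Qed.

Lemma Astar_coef_eq0 (L M : nat) : (M.+1 < L)%N -> Astar_coef p L M = 0.
Proof.
move=> lt_ML; rewrite /Astar_coef (gtn_eqF lt_ML) (gtn_eqF (ltnW lt_ML)).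
by rewrite ltn_eqF // ltnS (ltnW (ltnW lt_ML)).
Qed.

(* Otherwise the span of the first k+1 kets would be invariant under A and A*. *)
Lemma Astar_up_neq0 (k : nat) :
  irreducible_action A As -> (k < n)%N -> Astar_coef p k.+1 k != 0.
Proof.
move=> hirr lt_kn; apply/eqP => up0.
(* The span is encoded as the common kernel of the coordinates beyond k, so that membership means
   vanishing of coordinates ([UP]). *)
pose U := (\bigcap_(j < n.+1 | (k < j)%N) lker (linfun (ket_coord j : V -> F^o)))%VS.
have UP w : reflect (forall j : 'I_n.+1, (k < j)%N -> ket_coord j w = 0) (w \in U).
  apply: (iffP idP) => [Uw j lt_kj|Uw].
    have /subv_bigcapP/(_ j lt_kj)/subvP/(_ w Uw) := subvv U.
    by rewrite memv_ker lfunE => /eqP.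
  rewrite memvE; apply/subv_bigcapP => j lt_kj.
  by rewrite -memvE memv_ker lfunE /= Uw.
have AU : (A @: U <= U)%VS.
  apply/subvP => _ /memv_imgP[w /UP Uw ->]; apply/UP => j lt_kj.
  by rewrite ket_coord_A Uw ?mulr0.
have AsU : (As @: U <= U)%VS.
  apply/subvP => _ /memv_imgP[w /UP Uw ->]; apply/UP => j lt_kj.
  rewrite (ket_coord_tridiag hAs) big1 // => M _.
  have [lt_kM|le_Mk] := ltnP k M; first by rewrite Uw ?mul0r.
  have [-> |ne_Mk] := eqVneq (M : nat) k; last first.
    rewrite Astar_coef_eq0 ?mulr0 //.
    by rewrite (leq_trans _ lt_kj) // ltnS ltn_neqAle ne_Mk.
  have [-> |ne_jk] := eqVneq (j : nat) k.+1; first by rewrite up0 mulr0.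
  by rewrite Astar_coef_eq0 ?mulr0 // ltn_neqAle eq_sym ne_jk.
(* [U] contains [ket ord0], hence is not 0, and misses the ket of index k+1, hence is not
   everything. *)
have [U0|Ufull] := hirr U AU AsU.
  have : ket ord0 \in U by apply/UP => j lt_kj; rewrite ket_coordE -val_eqE /= ltn_eqF // (leq_trans _ lt_kj).
  rewrite U0 memv0 => /eqP ket0; have := ket_coordE ord0 ord0.
  by rewrite ket0 linear0 eqxx => /esym/eqP; rewrite oner_eq0.
have k1 : (k.+1 < n.+1)%N by [].
have /UP/(_ (Ordinal k1) (ltnSn k)) : ket (Ordinal k1) \in U by rewrite Ufull memvf.
by rewrite ket_coordE eqxx => /eqP; rewrite oner_eq0.
Qed.

(** Entries of Z in the eigenbasis of A: as A is diagonal there, the q-commutator only rescales each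
    entry of A* by a combination of two eigenvalues. *)
Definition third_coef (L M : nat) : F :=
  (aw_rho p)^-1 * (Astar_coef p L M * (q * theta p M - q^-1 * theta p L)
                    + aw_omega p / (q - q^-1) *+ (L == M)).

Local Notation Z := (aw_third p A As).

Lemma aw_third_ket (M : 'I_n.+1) : Z (ket M) = \sum_(L < n.+1) third_coef L M *: ket L.
Proof.
have [_ _ Aket] := hket.
rewrite /aw_third /qcomm !(scale_lfunE, add_lfunE, opp_lfunE, comp_lfunE, id_lfunE) Aket linearZ /= hAs.
rewrite (linear_sum A) /= !scaler_sumr -sumrN -big_split /=.
have -> : (aw_omega p / (q - q^-1)) *: ket M
    = \sum_(L < n.+1) (aw_omega p / (q - q^-1) *+ (L == M)) *: ket L.
  rewrite (bigD1 M) //= big1 ?addr0 ?eqxx // => j /negPf ne_jM.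
  by rewrite ne_jM mulr0n scale0r.
rewrite -big_split scaler_sumr; apply: eq_bigr => L _.
rewrite [A (_ *: _)]linearZ /= Aket !scalerA -scalerBl -scalerDl scalerA; congr (_ *: _).
by rewrite /third_coef val_eqE; congr (_ * _); ring.
Qed.

Lemma third_coef_eq0 (L M : nat) : (M.+1 < L)%N -> third_coef L M = 0.
Proof.
move=> lt_ML; rewrite /third_coef Astar_coef_eq0 // mul0r add0r gtn_eqF ?mulr0n ?mulr0 //.
exact: ltnW.
Qed.

(** Z raises the index by at most one, so k steps from 0 never pass k, and the only path reaching k
    goes up every time. *)
Lemma ket_coord_iter_third (k : nat) (j : 'I_n.+1) : (k <= j)%N ->
  ket_coord j (iter k Z (ket ord0)) = (\prod_(l < k) third_coef l.+1 l) *+ (j == k :> nat).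
Proof.
elim: k j => [|k IH] j le_kj.
  by rewrite big_ord0 ket_coordE eq_sym.
rewrite iterS (ket_coord_tridiag aw_third_ket) [X in _ = X *+ _]big_ord_recr /=.
have k1 : (k < n.+1)%N by exact: leq_trans (leqW le_kj) (ltn_ord j).
rewrite (bigD1 (Ordinal k1)) //= big1 ?addr0.
  rewrite IH //= eqxx mulr1n.
  have [-> //|ne_jk] := eqVneq (j : nat) k.+1.
  by rewrite third_coef_eq0 ?mulr0 // ltn_neqAle eq_sym ne_jk.
move=> M ne_Mk.
have [lt_kM|le_Mk] := leqP k M.
  by rewrite IH // -val_eqE /= in ne_Mk *; rewrite (negPf ne_Mk) mulr0n mul0r.
by rewrite third_coef_eq0 ?mulr0 // (leq_trans _ le_kj).
Qed.

Lemma ket_coord_monic (r : {poly F}) (M : 'I_n.+1) : r \is monic -> size r = M.+1 ->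
  ket_coord M (orbit_poly Z (ket ord0) r) = \prod_(l < M) third_coef l.+1 l.
Proof.
move=> /monicP r_monic sz_r; rewrite /orbit_poly /monext sz_r linear_sum big_ord_recr /= big1.
  rewrite add0r ket_coordZ ket_coord_iter_third // eqxx mulr1n.
  by rewrite -[X in r`_X]/((M.+1).-1) -sz_r -/(lead_coef r) r_monic mul1r.
by move=> i _; rewrite ket_coordZ ket_coord_iter_third ?(ltnW (ltn_ord i)) // gtn_eqF ?ltn_ord ?mulr0n ?mulr0.
Qed.

(** Z sends [ket ord0] to a vector with components only at indices 0 and 1; the second term corrects
    the eigenvalue on the component at 0. This is the second starting value of L. *)
Lemma aw_third_ket0 :
  A (Z (ket ord0)) = theta p 1 *: Z (ket ord0)
    + ((theta p 0 - theta p 1) * third_coef 0 0) *: ket ord0.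
Proof.
have [_ _ Aket] := hket.
rewrite (aw_third_ket ord0) linear_sum scaler_sumr /= [LHS]big_ord_recl [X in _ = X + _]big_ord_recl /=.
rewrite addrAC linearZ /= Aket !scalerA -scalerDl; congr (_ *: _ + _); first by rewrite /=; ring.
apply: eq_bigr => i _; rewrite linearZ /= Aket !scalerA; congr (_ *: _).
rewrite !lift0; have [-> |i0] := eqVneq (i : nat) 0%N; first by rewrite mulrC.
by rewrite third_coef_eq0 ?mul0r ?mulr0 // ltnS lt0n.
Qed.

End LeonardBasis.

(** * The Bethe equations as a difference equation *)

Lemma sqr_sub1_neq0 {F : fieldType} (x : F) : b_fun x != 0 -> x ^+ 2 - 1 != 0.
Proof.
apply: contraNneq => /subr0_eq x2; rewrite /b_fun subr_eq0; apply/eqP/esym.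
exact: (mulr1_eq (x2 : x * x = 1)).
Qed.

Section SpectralCurve.
Context {F : fieldType} (p : aw_params F).
Local Notation n := (aw_2s p).
Local Notation q := (aw_q p).
Local Notation b := (aw_b p).
Local Notation c := (aw_c p).
Hypothesis hgen : aw_generic p.

Lemma q4_sub1_neq0 : (q * q) ^+ 2 - 1 != 0.
Proof.
have [_ qm qp] := generic_q hgen.
have -> : (q * q) ^+ 2 - 1 = (q ^+ 2 - 1) * (q ^+ 2 + 1) by ring.
by rewrite mulf_neq0.
Qed.

Lemma q2_sub_neq0 : q ^+ 2 - q ^- 2 != 0.
Proof.
have [q0 _ _] := generic_q hgen.
have -> : q ^+ 2 - q ^- 2 = ((q * q) ^+ 2 - 1) / q ^+ 2 by field.
by rewrite mulf_neq0 ?q4_sub1_neq0 ?invr_eq0 ?expf_neq0.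
Qed.

(** The root of [calB chi u] viewed as a polynomial in Z. Up to a nonzero constant factor it is
    [bethe_U], so admissible solutions give distinct roots. *)
Definition spec_root (u : F) : F :=
  - ((q * u ^ 2 + q^-1 * u ^ (-2)) / (q ^ 2 - q ^ (-2))).

(** The two shifts of z = [spec_root u] have sum (q^2 + q^-2) z and product z^2 + 1, hence are the
    two roots required by [aw_op_factor]. *)
Lemma spec_root_shift_sqr (u : F) : u != 0 ->
  spec_root (u / q) ^+ 2 = (q ^+ 2 + (q ^+ 2)^-1) * spec_root u * spec_root (u / q)
    - spec_root u ^+ 2 - 1
  /\ spec_root (q * u) ^+ 2 = (q ^+ 2 + (q ^+ 2)^-1) * spec_root u * spec_root (q * u)
    - spec_root u ^+ 2 - 1.
Proof.
move=> u0; have [q0 qm qp] := generic_q hgen.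
rewrite /spec_root -![_ ^ (-2)]exprnN -![_ ^ 2]exprnP.
by split; field; rewrite q0 u0 q4_sub1_neq0.
Qed.

(* The factor for which the two coefficients of the Bethe equations become the
   coefficients of L. *)
Definition tq_scale (u : F) : F := - ((q + q^-1) * u * b_fun (u ^ 2))^-1.

Definition tq_minus (u : F) : F :=
  tq_scale u * (- (b_fun (u ^ 2) / b_fun (q * u ^ 2)) * Lambda1 p (-1) u).

Definition tq_plus (u : F) : F := tq_scale u * Lambda2 p (-1) u.

Section Identities.
Variable u : F.
Hypotheses (u0 : u != 0) (u2 : u ^ 2 != u ^ (-2)) (qu : b_fun (q * u ^ 2) != 0).
Hypothesis n_gt0 : (0 < n)%N.

Local Notation Q := (q ^+ n).
Local Notation bs := (aw_bs p).
Local Notation cs := (aw_cs p).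
Local Notation ze := (aw_zeta p).

Let Q0 : Q != 0.
Proof. by have [q0 _ _] := generic_q hgen; rewrite expf_neq0. Qed.

Lemma qn1E : q ^ (n%:Z + 1) = Q * q.
Proof. by have [q0 _ _] := generic_q hgen; rewrite expfzDr. Qed.

Lemma qnP1E : q ^ (n%:Z - 1) = Q / q.
Proof. by have [q0 _ _] := generic_q hgen; rewrite expfzDr. Qed.

Lemma qnV1E : q ^ (- n%:Z - 1) = (Q * q)^-1.
Proof. by rewrite -opprD -invr_expz qn1E. Qed.

Lemma qnE : q ^ n = Q. Proof. by []. Qed.

Lemma qnVE : q ^ (- n%:Z) = Q^-1.
Proof. by rewrite -invr_expz. Qed.

Lemma u_denominators : (u ^+ 2) ^+ 2 - 1 != 0 /\ (q * u ^+ 2) ^+ 2 - 1 != 0.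
Proof.
split; apply: sqr_sub1_neq0 => //.
by rewrite /b_fun subr_eq0 -[_ ^- 2]/(u ^ (-2)).
Qed.

(** The factor b(u^2) cancels against [tq_scale], so b(q u^2) is the only denominator left that has
    to be assumed nonzero besides u. *)
Lemma tq_minusE : tq_minus u =
  (q + q^-1)^-1 / (q * u ^+ 2 - (q * u ^+ 2)^-1)
  * ((Q * q)^-1 * (Q * q * u * ze^-1 - u^-1 * ze) * (Q * q * u * ze - u^-1 * ze^-1)
     * (u * cs / Q + u^-1 * b * Q) * (u * (c / cs) + u^-1)).
Proof.
have [q0 qm qp] := generic_q hgen.
rewrite /tq_minus /tq_scale /Lambda1 /b_fun.
have -> : ((1 - (-1)) %/ 2)%Z = 1 by [].
have -> : ((1 + (-1)) %/ 2)%Z = 0 by [].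
have -> : u ^ (-1) = u^-1 by [].
rewrite !expr1z expr0z qn1E qnV1E qnE qnVE mulr1 invrK -[u ^ 2]exprnP.
have [_ [_ cs0 ze0] _ _ _] := hgen.
have [u4 qu4] := u_denominators.
by field; rewrite q0 u0 cs0 ze0 Q0 -!expr2 qp qu4 u4.
Qed.

Lemma tq_plusE : tq_plus u =
  - (q + q^-1)^-1 / (q * u ^+ 2 - (q * u ^+ 2)^-1)
  * ((Q * q)^-1 * (Q / q * u^-1 * ze - u * ze^-1) * (Q / q * u^-1 * ze^-1 - u * ze)
     * (q ^+ 2 * u * b * Q + u^-1 * cs / Q) * (q ^+ 2 * u + u^-1 * (c / cs))).
Proof.
have [q0 qm qp] := generic_q hgen.
rewrite /tq_plus /tq_scale /Lambda2 /b_fun.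
have -> : ((1 - (-1)) %/ 2)%Z = 1 by [].
have -> : ((1 + (-1)) %/ 2)%Z = 0 by [].
have -> : u ^ (-1) = u^-1 by [].
rewrite !expr1z expr0z qnV1E qnP1E qnE qnVE mulr1 -![_ ^ (-2)]exprnN -![_ ^ 2]exprnP.
have [_ [_ cs0 ze0] _ _ _] := hgen.
have [u4 qu4] := u_denominators.
by field; rewrite q0 u0 cs0 ze0 Q0 -!expr2 qp qu4 u4.
Qed.

(** The condition [fsum] of [aw_op_factor] at z = [spec_root u], with the constant [b1] supplied by
    [aw_third_ket0]. *)
Lemma tq_sum :
  tq_minus u + tq_plus u
  = theta p 1 * spec_root u + (theta p 0 - theta p 1) * third_coef p 0 0
    - spec_root u * theta p 0.
Proof.
have [q0 qm qp] := generic_q hgen.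
have [[_ b0 c0] [bs0 cs0 ze0] _ bc gen] := hgen.
have [u4 qu4] := u_denominators.
have [cb _] := gen 0 isT; rewrite mulr1 in cb.
(* [n_gt0] brings k = 1 into the range of the genericity assumption, so that the denominator of
   A*_{0,1} does not vanish. *)
have [cbq _] : (c - b * q ^+ 2 != 0) /\ _ := gen 1%N (ltnW (leq_pmulr 2 n_gt0)).
rewrite tq_minusE tq_plusE /third_coef /Astar_coef /= Astar_up0 (Astar_down1 hgen).
rewrite !thetaE /theta_star /aw_rho /aw_omega /spec_root.
rewrite qn1E qnV1E qnE qnVE mulr0 oppr0 !expr0z -![_ ^ (-2)]exprnN -![_ ^ 2]exprnP.
(* Solving b c = b* c* for c* leaves an identity of rational functions in independent variables. *)
have csE : cs = b * c / bs by rewrite bc mulrC mulKf.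
rewrite csE expr0 expr1 mulr1n.
by field; rewrite oner_neq0 oppr_eq0 mulf_neq0 // q0 q4_sub1_neq0 u0 -!expr2 qm Q0 bs0 ze0 cbq cb c0 b0 qu4 qp.
Qed.

(** The condition [fshift] of [aw_op_factor], with [k1] and [k0] read off from
    [aw_third_relation]. *)
Lemma tq_shifted_sum :
  tq_minus u * spec_root (u / q) + tq_plus u * spec_root (q * u)
  = (q ^+ 2 + (q ^+ 2)^-1 - 1) * spec_root u
      * (theta p 1 * spec_root u + (theta p 0 - theta p 1) * third_coef p 0 0)
    - (spec_root u ^+ 2 + 1) * theta p 0
    + (q - q^-1) * aw_eta p / aw_rho p * spec_root u
    + - (aw_eta (aw_swap p) / aw_rho p).
Proof.
have [q0 qm qp] := generic_q hgen.
have [[_ b0 c0] [bs0 cs0 ze0] _ bc gen] := hgen.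
have [u4 qu4] := u_denominators.
have [cb _] := gen 0 isT; rewrite mulr1 in cb.
have [cbq _] : (c - b * q ^+ 2 != 0) /\ _ := gen 1%N (ltnW (leq_pmulr 2 n_gt0)).
rewrite tq_minusE tq_plusE /third_coef /Astar_coef /= Astar_up0 (Astar_down1 hgen).
rewrite !thetaE /theta_star /aw_eta /aw_rho /aw_omega /spec_root /aw_swap /=.
rewrite qn1E qnV1E qnE qnVE mulr0 oppr0 !expr0z -![_ ^ (-2)]exprnN -![_ ^ 2]exprnP.
have csE : cs = b * c / bs by rewrite bc mulrC mulKf.
rewrite csE expr0 expr1 mulr1n.
by field; rewrite oner_neq0 oppr_eq0 mulf_neq0 // q0 q4_sub1_neq0 u0 -!expr2 qm Q0 bs0 ze0 cbq cb c0 b0 qu4 qp.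
Qed.

End Identities.

(* f and h are quotients of values of X - spec_root v at the shifted and unshifted
   points, which turns the Bethe equations into statements about roots of L r. *)
Lemma f_fun_spec_root (u v : F) : u != 0 -> v != 0 -> spec_root u != spec_root v ->
  f_fun p u v = (spec_root (u / q) - spec_root v) / (spec_root u - spec_root v).
Proof.
move=> u0 v0 ne_uv; have [q0 qm qp] := generic_q hgen.
have den : b_fun (v / u) * b_fun (q * u * v) = (q ^+ 2 - q ^- 2) * (spec_root u - spec_root v).
  rewrite /b_fun /spec_root -![_ ^ (-2)]exprnN -![_ ^ 2]exprnP.
  by field; rewrite q0 u0 v0 q4_sub1_neq0.
have num : b_fun (q * v / u) * b_fun (u * v) = (q ^+ 2 - q ^- 2) * (spec_root (u / q) - spec_root v).
  rewrite /b_fun /spec_root -![_ ^ (-2)]exprnN -![_ ^ 2]exprnP.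
  by field; rewrite q0 u0 v0 q4_sub1_neq0.
by rewrite /f_fun num den -mulf_div divff ?q2_sub_neq0 // mul1r.
Qed.

Lemma h_fun_spec_root (u v : F) : u != 0 -> v != 0 -> spec_root u != spec_root v ->
  h_fun p u v = (spec_root (q * u) - spec_root v) / (spec_root u - spec_root v).
Proof.
move=> u0 v0 ne_uv; have [q0 qm qp] := generic_q hgen.
have den : b_fun (q * u * v) * b_fun (u / v) = - (q ^+ 2 - q ^- 2) * (spec_root u - spec_root v).
  rewrite /b_fun /spec_root -![_ ^ (-2)]exprnN -![_ ^ 2]exprnP.
  by field; rewrite q0 u0 v0 q4_sub1_neq0.
have num : b_fun (q ^+ 2 * u * v) * b_fun (q * u / v) = - (q ^+ 2 - q ^- 2) * (spec_root (q * u) - spec_root v).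
  rewrite /b_fun /spec_root -![_ ^ (-2)]exprnN -![_ ^ 2]exprnP.
  by field; rewrite q0 u0 v0 q4_sub1_neq0.
by rewrite /h_fun num den -mulf_div divff ?oppr_eq0 ?q2_sub_neq0 // mul1r.
Qed.

Lemma bethe_E_spec_root (M : nat) (u : 'I_M -> F) (i : 'I_M) :
  (forall j, u j != 0) -> injective (fun j => spec_root (u j)) ->
  bethe_E p (-1) u i = 0 ->
  tq_minus (u i) * \prod_(j < M | j != i) (spec_root (u i / q) - spec_root (u j))
  + tq_plus (u i) * \prod_(j < M | j != i) (spec_root (q * u i) - spec_root (u j)) = 0.
Proof.
(* The product of unshifted differences clears the denominators of [f_fun] and [h_fun], and
   [tq_scale] turns the two coefficients into [tq_minus] and [tq_plus]. *)
move=> u0 u_inj /(congr1 (fun x => tq_scale (u i)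
  * (\prod_(j < M | j != i) (spec_root (u i) - spec_root (u j))) * x)); rewrite mulr0 => <-.
have ne_s j : j != i -> spec_root (u i) != spec_root (u j).
  by apply: contraNneq => /u_inj ->.
set P := \prod_(j < M | j != i) (spec_root (u i) - spec_root (u j)).
have prodE (g : F -> F) (s : F) :
    (forall j, j != i -> g (u j) = (s - spec_root (u j)) / (spec_root (u i) - spec_root (u j))) ->
    \prod_(j < M | j != i) (s - spec_root (u j)) = P * \prod_(j < M | j != i) g (u j).
  move=> gE; rewrite -big_split; apply: eq_bigr => j ne_ji /=.
  by rewrite gE // mulrC divfK // subr_eq0 ne_s.
rewrite (prodE (f_fun p (u i))) => [|j ne_ji]; last exact: f_fun_spec_root (ne_s j ne_ji).
rewrite (prodE (h_fun p (u i))) => [|j ne_ji]; last exact: h_fun_spec_root (ne_s j ne_ji).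
rewrite /bethe_E /tq_minus /tq_plus; ring.
Qed.

End SpectralCurve.

(** * Bethe states as eigenvectors of A *)

Lemma prod_rev_ord {F : fieldType} (M : nat) (x : F) :
  \prod_(i < M) x ^+ rev_ord i = \prod_(i < M) x ^+ i.
Proof. by rewrite (reindex_inj rev_ord_inj); apply: eq_bigr => i _; rewrite rev_ordK. Qed.

Lemma bethe_vector_minusE {F : fieldType} (p : aw_params F) {V : vectType F}
    (A As : 'End(V)) (chi alpha : F) (Omega : V) (m0 : int) (M : nat) (u : 'I_M -> F) :
  bethe_vector (scrB_minus p A As chi alpha) Omega m0 u
  = (\prod_(i < M) (alpha^-1 * aw_q p ^ (m0 + 2 * (M%:Z - 1 - i%:Z) + 2) * u i
                    * (chi * b_fun (u i ^ 2))))
    *: orbit_poly (aw_third p A As) Omega (\prod_(i < M) ('X - (spec_root p (u i))%:P)).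
Proof.
rewrite -!(big_enum _ _ predT) /= -foldr_orbit_poly /bethe_vector.
elim: (enum 'I_M) => //= i l ->.
rewrite /scrB_minus /calB -/(aw_third p A As) !(scale_lfunE, add_lfunE, id_lfunE).
by rewrite scalerA /spec_root scaleNr opprK.
Qed.

Lemma spec_root_inj {F : fieldType} (p : aw_params F) (M : nat) (u : 'I_M -> F) :
  aw_generic p -> bethe_admissible p u -> injective (fun j => spec_root p (u j)).
Proof.
move=> hgen adm i j /= /oppr_inj /(mulIf _) eq_ij; apply/eqP/negPn/negP => /adm /eqP; apply.
by rewrite /bethe_U eq_ij // invr_eq0; exact: q2_sub_neq0.
Qed.

Lemma ket_bethe_minus {F : fieldType} (p : aw_params F) {V : vectType F}
    (A As : 'End(V)) (ket : 'I_(aw_2s p).+1 -> V) (chi alpha : F) (m0 : int) :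
  aw_generic p -> multfree_eigenbasis A (theta p) ket ->
  irreducible_action A As -> aw_relations p A As ->
  (forall M, As (ket M) = \sum_(L < (aw_2s p).+1) Astar_coef p L M *: ket L) ->
  chi != 0 ->
  (aw_q p ^ 2 - aw_q p ^ (-2)) * chi^-1 * alpha * aw_b p * aw_q p ^ (- m0) = -1 ->
  forall (M : 'I_(aw_2s p).+1) (u : 'I_M -> F), bethe_solution p (-1) u ->
  ket M = norm_minus p u *: bethe_vector (scrB_minus p A As chi alpha) (ket ord0) m0 u.
Proof.
move=> hgen hket hirr hrel hAs chi0 halpha M u [ntriv adm def bethe].
have [q0 qm qp] := generic_q hgen; have rho0 := aw_rho_neq0 hgen.
have u0 i : u i != 0 by have [] := ntriv i.
have u2 i : u i ^ 2 != u i ^ (-2) by have [] := ntriv i.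
have s_inj := spec_root_inj hgen adm.
(* An index i < M forces M > 0, hence 2s > 0; for M = 0 the conditions indexed by i are vacuous. *)
have n_gt0 (i : 'I_M) : (0 < aw_2s p)%N.
  by rewrite -ltnS (leq_trans _ (ltn_ord M)) // ltnS (leq_ltn_trans _ (ltn_ord i)).
rewrite bethe_vector_minusE; set r := \prod_(i < M) ('X - _).
set Z := aw_third p A As.
have Lr := aw_op_prod (th := theta p) (M := M) (theta_rec hgen) s_inj
  (fun i => (spec_root_shift_sqr hgen (u0 i)).1) (fun i => (spec_root_shift_sqr hgen (u0 i)).2)
  (fun i => tq_sum hgen (u0 i) (u2 i) (def i) (n_gt0 i))
  (fun i => tq_shifted_sum hgen (u0 i) (u2 i) (def i) (n_gt0 i))
  (fun i => bethe_E_spec_root hgen u0 s_inj (bethe i)).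
have [_ _ Aket] := hket.
have AZ w : Z (Z (A w)) - (aw_q p ^+ 2 + (aw_q p ^+ 2)^-1) *: Z (A (Z w)) + A (Z (Z w))
  = - A w + ((aw_q p - (aw_q p)^-1) * aw_eta p / aw_rho p) *: Z w
    + (- (aw_eta (aw_swap p) / aw_rho p)) *: w.
  by rewrite scaleNr; exact: aw_third_relation.
have Ar : A (orbit_poly Z (ket ord0) r) = theta p M *: orbit_poly Z (ket ord0) r.
  by rewrite (orbit_poly_aw_op r (Aket ord0) (aw_third_ket0 hket hAs) AZ) Lr orbit_polyZ.
rewrite (eigenvector_ket hket Ar) (ket_coord_monic hket hAs); first last.
- by rewrite size_prod_XsubC /index_enum unlock -enumT size_enum_ord.
- exact: monic_prod_XsubC.
rewrite !scalerA -[LHS]scale1r; congr (_ *: _); apply/esym.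
pose K := alpha^-1 * aw_q p ^ (m0 + 2) * chi.
have -> : \prod_(i < M) (alpha^-1 * aw_q p ^ (m0 + 2 * (M%:Z - 1 - i%:Z) + 2) * u i * (chi * b_fun (u i ^ 2)))
   = \prod_(i < M) (K * (u i * b_fun (u i ^ 2))) * \prod_(i < M) (aw_q p ^+ 2) ^+ i.
  (* The powers of q decrease along the Bethe state while the entries of Z are indexed upwards;
     reversing the powers pairs them index by index. *)
  rewrite -prod_rev_ord -big_split; apply: eq_bigr => i _ /=.
  have -> : m0 + 2 * (M%:Z - 1 - i%:Z) + 2 = m0 + 2 + 2 * (M - i.+1)%N%:Z.
    by rewrite -subzn ?ltn_ord // intS; ring.
  rewrite [aw_q p ^ (m0 + 2 + _)]expfzDr // -exprz_exp /K -!exprnP; ring.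
(* Each index contributes 1: q^(2i) cancels the power in [q_theta_sub_theta_succ], the norm cancels
   u_i, b(u_i^2) and the entry of A*, and the condition on alpha does the rest. *)
rewrite /norm_minus -!big_split big1 //= => i _.
have up0 : Astar_coef p i.+1 i != 0.
  by apply: Astar_up_neq0 hket hAs _ hirr _; rewrite (leq_trans (ltn_ord i)) // -ltnS.
rewrite /third_coef q_theta_sub_theta_succ // gtn_eqF // mulr0n addr0 /K /aw_rho.
rewrite expfzDr //.
have [[_ b0 c0] _ _ _ _] := hgen.
have d0 : aw_q p ^ 2 - aw_q p ^ (-2) != 0 by exact: q2_sub_neq0.
have qm0 : aw_q p ^ m0 != 0 by exact: expfz_neq0.
have q2i : aw_q p ^+ 2 ^+ i != 0 by rewrite !expf_neq0.
have bu : b_fun (u i ^ 2) != 0 by rewrite /b_fun subr_eq0 invr_expz.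
move: halpha; rewrite -invr_expz; move: (_ - _ ^ (-2)) d0 (_ ^ m0) qm0 => D d0 z z0 halpha'.
have -> : alpha = - (chi * z) / (D * aw_b p).
  have /(canRL (divfK z0)) := halpha'; rewrite mulN1r => zE.
  by rewrite -mulrN -zE; field; rewrite b0 chi0 d0.
rewrite -[_ ^ 2 in X in X * chi]exprnP; field.
by rewrite q2i q0 d0 !oppr_eq0 !mulf_neq0 // b0 up0 bu u0.
Qed.

(** * The symmetry exchanging A and its dual *)

Section ClosedForms.
Context {F : fieldType} (p : aw_params F).
Local Notation n := (aw_2s p).
Local Notation q := (aw_q p).
Local Notation Q := (q ^+ n).
Hypothesis q0 : q != 0.

Lemma exprz_double (m : nat) : q ^ (2 * m%:Z) = (q ^+ m) ^+ 2.
Proof. by rewrite mulrC -exprz_exp. Qed.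

Lemma exprz_quadruple (m : nat) : q ^ (4 * m%:Z) = (q ^+ m) ^+ 4.
Proof. by rewrite mulrC -exprz_exp. Qed.

(** With all exponents expressed through q^M and q^(2s), the reflection below becomes an identity of
    rational functions. *)
Lemma Astar_upE (M : nat) : Astar_up p M =
  q ^+ 2 / Q ^+ 2 *
  ((1 - (q ^+ M) ^+ 2) * (aw_c p - aw_b p * ((q ^+ M) ^+ 2 * Q ^+ 2))
   * (aw_bs p * (Q / q) / aw_zeta p ^+ 2 + aw_b p * ((q ^+ M) ^+ 2 / q ^+ 2))
   * (aw_c p * (Q / q) * aw_zeta p ^+ 2 + aw_cs p * ((q ^+ M) ^+ 2 / q ^+ 2)))
  / ((aw_c p - aw_b p * ((q ^+ M) ^+ 4 / q ^+ 2)) * (aw_c p - aw_b p * (q ^+ M) ^+ 4)).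
Proof.
rewrite /Astar_up !(expfzDr _ _ q0) -[q ^ (- (2 * n%:Z))]invr_expz.
by rewrite !exprz_double !exprz_quadruple.
Qed.

Lemma Astar_downE (M : nat) : Astar_down p M =
  ((1 - (q ^+ M) ^+ 2 / Q ^+ 2 / q ^+ 2) * (aw_c p - aw_b p * ((q ^+ M) ^+ 2 / q ^+ 2))
   * (aw_c p + aw_bs p / aw_zeta p ^+ 2 * ((q ^+ M) ^+ 2 * Q / q))
   * (aw_cs p + aw_b p * aw_zeta p ^+ 2 * ((q ^+ M) ^+ 2 * Q / q)))
  / ((aw_c p - aw_b p * ((q ^+ M) ^+ 4 / q ^+ 4)) * (aw_c p - aw_b p * ((q ^+ M) ^+ 4 / q ^+ 2))).
Proof.
rewrite /Astar_down !(expfzDr _ _ q0) -[q ^ (- (2 * n%:Z))]invr_expz.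
by rewrite !exprz_double !exprz_quadruple.
Qed.

End ClosedForms.

(** Compares quotients whose denominators may vanish: genericity says nothing about those of
    [Astar_up] and [Astar_down] at indices out of range. *)
Lemma eq_divr_scaled {F : fieldType} (k x y x' y' : F) :
  k != 0 -> x' = k * x -> y' = k * y -> x' / y' = x / y.
Proof. by move=> k0 -> ->; rewrite -mulf_div divff ?mul1r. Qed.

Section Reflection.
Context {F : fieldType} (p : aw_params F).
Local Notation n := (aw_2s p).
Local Notation q := (aw_q p).
Local Notation b := (aw_b p).
Local Notation c := (aw_c p).
Local Notation bs := (aw_bs p).
Local Notation cs := (aw_cs p).
Local Notation ze := (aw_zeta p).

Definition aw_reflect : aw_params F := AWParams n q^-1 cs bs c b ze^-1.

Local Notation p' := aw_reflect.

Hypothesis hgen : aw_generic p.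

Lemma aw_generic_reflect : aw_generic p'.
Proof.
have [[q0 b0 c0] [bs0 cs0 ze0] q_pow bc gen] := hgen.
split=> /=; [by rewrite invr_eq0 | by rewrite invr_eq0 | | by rewrite mulrC -bc mulrC |].
  by move=> k k_gt0; rewrite exprVn invr_eq1 q_pow.
move=> k le_k; have [g1 g2] := gen k le_k.
have qk0 : q ^+ (2 * k) != 0 by rewrite expf_neq0.
rewrite exprVn; split.
  have -> : bs - cs / q ^+ (2 * k) = - (cs - bs * q ^+ (2 * k)) / q ^+ (2 * k) by field.
  by rewrite mulf_neq0 ?oppr_eq0 ?invr_eq0.
have -> : b - c / q ^+ (2 * k) = - (c - b * q ^+ (2 * k)) / q ^+ (2 * k) by field.
by rewrite mulf_neq0 ?oppr_eq0 ?invr_eq0.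
Qed.

Lemma theta_reflect (N : nat) : theta p' N = theta_star p N.
Proof. by rewrite /theta /theta_star /= !exprz_inv opprK addrC. Qed.

Lemma aw_rho_reflect : aw_rho p' = aw_rho p.
Proof.
have [_ _ _ bc _] := hgen.
by rewrite /aw_rho /= bc !exprz_inv opprK mulrC [cs * bs]mulrC; ring.
Qed.

Lemma aw_omega_reflect : aw_omega p' = aw_omega p.
Proof.
have [_ _ _ bc _] := hgen.
rewrite /aw_omega /= !exprz_inv [- (n%:Z + 1)]opprD [- (- n%:Z - 1)]opprD !opprK invrK bc.
move: (q ^ n) (q ^ (- n%:Z)) (q ^ (n%:Z + 1)) (q ^ (- n%:Z - 1)) (ze ^ 2) (ze ^ (-2)) => *; ring.
Qed.

Lemma aw_eta_reflect : aw_eta p' = aw_eta (aw_swap p).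
Proof.
rewrite /aw_eta /= !exprz_inv [- (n%:Z + 1)]opprD [- (- n%:Z - 1)]opprD !opprK invrK [q^-1 + q]addrC.
move: (q ^ n) (q ^ (- n%:Z)) (q ^ (n%:Z + 1)) (q ^ (- n%:Z - 1)) (q ^ (-2)) (q ^ 2) (ze ^ 2) (ze ^ (-2)) => *; ring.
Qed.

Lemma aw_eta_swap_reflect : aw_eta (aw_swap p') = aw_eta p.
Proof.
rewrite /aw_eta /= !exprz_inv [- (n%:Z + 1)]opprD [- (- n%:Z - 1)]opprD !opprK invrK [q^-1 + q]addrC.
move: (q ^ n) (q ^ (- n%:Z)) (q ^ (n%:Z + 1)) (q ^ (- n%:Z - 1)) (q ^ (-2)) (q ^ 2) (ze ^ 2) (ze ^ (-2)) => *; ring.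
Qed.

Lemma Astar_coef_reflect (L M : nat) : Astar_coef p' L M = Astar_coef (aw_dual p) L M.
Proof.
have [[q0 b0 c0] [bs0 cs0 ze0] _ _ _] := hgen.
have qV0 : q^-1 != 0 by rewrite invr_eq0.
have up N : Astar_up p' N = Astar_up (aw_dual p) N.
  rewrite (Astar_upE (p := p') qV0) (Astar_upE (p := aw_dual p) q0) /= !exprVn.
  have := expf_neq0 n q0; have := expf_neq0 N q0.
  move: (q ^+ n) (q ^+ N) => Q x x0 Q0.
  (* The scale is read off from the denominators: the reflection multiplies their two factors by -
     q^2 / x^4 and - 1 / x^4. *)
  apply: (@eq_divr_scaled _ (q ^+ 2 / x ^+ 8)).
  - by rewrite mulf_neq0 ?invr_eq0 ?expf_neq0.
  - by field; rewrite ?oner_neq0 ?q0 ?x0 ?Q0 ?ze0.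
  - by field; rewrite q0 x0 oner_neq0.
have down N : Astar_down p' N = Astar_down (aw_dual p) N.
  rewrite (Astar_downE (p := p') qV0) (Astar_downE (p := aw_dual p) q0) /= !exprVn.
  have := expf_neq0 n q0; have := expf_neq0 N q0.
  move: (q ^+ n) (q ^+ N) => Q x x0 Q0.
  apply: (@eq_divr_scaled _ (q ^+ 6 / x ^+ 8)).
  - by rewrite mulf_neq0 ?invr_eq0 ?expf_neq0.
  - by field; rewrite ?oner_neq0 ?q0 ?x0 ?Q0 ?ze0.
  - by field; rewrite q0 x0 oner_neq0.
have th0 : theta_star p' 0 = theta_star (aw_dual p) 0.
  by rewrite /theta_star /= mulr0 oppr0 !expr0z addrC.
by rewrite /Astar_coef !up !down th0.
Qed.

Lemma aw_relations_reflect {V : vectType F} (A As : 'End(V)) :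
  aw_relations p A As -> aw_relations p' As A.
Proof.
have [[q0 _ _] _ _ _ _] := hgen.
(* The double bracket is invariant under q -> q^-1, so the reflection merely exchanges the two
   relations. *)
have qcommE (X Y : 'End(V)) : qcomm q X (qcomm q^-1 X Y) = qcomm q^-1 X (qcomm q X Y).
  apply/lfunP => v; apply: scalar_ext => f.
  rewrite /qcomm !(scale_lfunE, add_lfunE, opp_lfunE, comp_lfunE) !(lfun_linearE, scalarE).
  by field; rewrite q0 oner_neq0.
move=> [R1 R2]; split; rewrite /= ?invrK qcommE.
  by rewrite aw_rho_reflect aw_omega_reflect aw_eta_reflect.
by rewrite aw_rho_reflect aw_omega_reflect aw_eta_swap_reflect.
Qed.

Lemma aw_third_reflect {V : vectType F} (A As : 'End(V)) :
  aw_third p' As A = - aw_third p A As.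
Proof.
rewrite /aw_third aw_rho_reflect aw_omega_reflect /=.
have -> : qcomm q^-1 A As = - qcomm q As A by rewrite /qcomm invrK opprB.
have -> : aw_omega p / (q^-1 - q^-1^-1) = - (aw_omega p / (q - q^-1)).
  by rewrite invrK -opprB invrN mulrN.
by rewrite scaleNr -opprD scalerN.
Qed.

Lemma b_funV (x : F) : b_fun x^-1 = - b_fun x.
Proof. by rewrite /b_fun invrK opprB. Qed.

(** Both Z and g(u) change sign, the latter through q^2 - q^-2, and the prefactor b(u^2)
    compensates. *)
Lemma calB_reflect {V : vectType F} (A As : 'End(V)) (chi u : F) :
  calB p' As A chi u^-1 = calB p A As chi u.
Proof.
rewrite /calB -/(aw_third p' As A) -/(aw_third p A As) aw_third_reflect.
rewrite !exprz_inv -[u ^ (- 2)]invr_expz b_funV.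
rewrite mulrN scaleNr -scalerN opprD opprK -scaleNr.
congr (_ *: (_ + _ *: _)).
by rewrite /= opprK invrK addrC -mulrN -invrN opprB.
Qed.

Lemma Lambda1_reflect (w : F) : w != 0 -> Lambda1 p' (-1) w^-1 = Lambda1 p 1 w.
Proof.
move=> w0; have gen' := aw_generic_reflect.
have [[q0 b0 c0] [bs0 cs0 ze0] _ _ _] := hgen.
rewrite /Lambda1.
(* up to conversion these two rewrites also catch the exponents of the case eps = 1 *)
have -> : ((1 - (-1)) %/ 2)%Z = 1 by [].
have -> : ((1 + (-1)) %/ 2)%Z = 0 by [].
have -> : w^-1 ^ (-1) = w by rewrite exprN1 invrK.
rewrite (qn1E gen') (qnV1E gen') (qnVE p') (qnE p').
rewrite (qn1E hgen) (qnV1E hgen) (qnVE p) (qnE p) /= exprVn !expr0z !expr1z.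
have := expf_neq0 n q0; move: (q ^+ n) => Q Q0.
by field; rewrite q0 w0 b0 ze0 Q0 oner_neq0.
Qed.

Lemma Lambda2_reflect (w : F) : w != 0 -> b_fun (q * w ^ 2) != 0 ->
  Lambda2 p' (-1) w^-1 = Lambda2 p 1 w.
Proof.
move=> w0 qw; have gen' := aw_generic_reflect.
have [[q0 b0 c0] [bs0 cs0 ze0] _ _ _] := hgen.
rewrite /Lambda2.
have -> : ((1 - (-1)) %/ 2)%Z = 1 by [].
have -> : ((1 + (-1)) %/ 2)%Z = 0 by [].
have -> : w^-1 ^ (-1) = w by rewrite exprN1 invrK.
rewrite (qnP1E gen') (qnV1E gen') (qnVE p') (qnE p').
rewrite (qnP1E hgen) (qnV1E hgen) (qnVE p) (qnE p) /= exprVn !expr0z !expr1z !exprz_inv !opprK.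
have := expf_neq0 n q0; move: (q ^+ n) => Q Q0.
rewrite -![_ ^ (-2)]exprnN -![_ ^ 2]exprnP.
have qw2 : (q * w ^+ 2) ^+ 2 - 1 != 0 by exact: sqr_sub1_neq0.
have qw3 : 1 + - (q * w ^+ 2) * (q * w ^+ 2) != 0.
  by rewrite mulNr -opprB oppr_eq0 -expr2.
by field; rewrite w0 b0 Q0 ze0 q0 oner_neq0 qw3 -expr2 qw2.
Qed.

Lemma bethe_solution_reflect (N : nat) (w : 'I_N -> F) :
  bethe_solution p 1 w -> bethe_solution p' (-1) (fun i => (w i)^-1).
Proof.
have [[q0 b0 c0] [bs0 cs0 ze0] _ _ _] := hgen.
move=> [ntriv adm def bethe]; split.
- by move=> i; have [w0 w2] := ntriv i; rewrite invr_eq0 !exprz_inv opprK [_ ^ _ == _]eq_sym.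
- move=> i j /adm; apply: contraNneq.
  rewrite /bethe_U /= invrK !exprz_inv !opprK [q^-1 + q]addrC ![q^-1 * _ + _]addrC.
  by move=> ->.
- by move=> i; rewrite /= exprz_inv -[(w i) ^ (-2)]invr_expz -invfM b_funV oppr_eq0; exact: def.
move=> i; rewrite -[RHS](bethe i) /bethe_E.
have [wi0 w2] := ntriv i.
have mV (x y : F) : x^-1 * y^-1 = (x * y)^-1 by rewrite invfM.
have fE v : f_fun p' (w i)^-1 v^-1 = f_fun p (w i) v.
  by rewrite /f_fun /= ?(mV, b_funV, mulrNN).
have hE v : h_fun p' (w i)^-1 v^-1 = h_fun p (w i) v.
  by rewrite /h_fun /= exprVn ?(mV, b_funV, mulrNN).
rewrite (Lambda1_reflect wi0) (Lambda2_reflect wi0 (def i)).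
congr (_ * _ * _ + _ * _).
- by rewrite /= exprz_inv -[(w i) ^ (-2)]invr_expz -invfM !b_funV invrN mulrNN.
- by apply: eq_bigr => j _; exact: fE.
by apply: eq_bigr => j _; exact: hE.
Qed.

End Reflection.

Lemma kets_bethe_plus {F : fieldType} (p : aw_params F) {V : vectType F}
    (A As : 'End(V)) (kets : 'I_(aw_2s p).+1 -> V) (chi alpha : F) (m0 : int) :
  aw_generic p -> multfree_eigenbasis As (theta_star p) kets ->
  irreducible_action A As -> aw_relations p A As ->
  (forall N, A (kets N) = \sum_(L < (aw_2s p).+1) Astar_coef (aw_dual p) L N *: kets L) ->
  chi != 0 ->
  (aw_q p ^ 2 - aw_q p ^ (-2)) * chi^-1 * alpha * aw_cs p * aw_q p ^ m0 = 1 ->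
  forall (N : 'I_(aw_2s p).+1) (w : 'I_N -> F), bethe_solution p 1 w ->
  kets N = norm_plus p w *: bethe_vector (scrB_plus p A As chi alpha) (kets ord0) m0 w.
Proof.
move=> hgen [basis_kets theta_inj As_kets] hirr hrel hA chi0 halpha N w sol_w.
have hkets : multfree_eigenbasis As (theta (aw_reflect p)) (kets : 'I_(aw_2s (aw_reflect p)).+1 -> V).
  split=> [//|M M' /=|M]; rewrite ?theta_reflect //; exact: theta_inj.
have hirr' : irreducible_action As A by move=> U AsU AU; exact: hirr.
have hA' M : A (kets M) = \sum_(L < (aw_2s (aw_reflect p)).+1) Astar_coef (aw_reflect p) L M *: kets L.
  by rewrite hA; apply: eq_bigr => L _; rewrite Astar_coef_reflect.
(* The reflected b is c*, and q^2 - q^-2 changes sign, which turns the value 1 into -1. *)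
have halpha' : (aw_q (aw_reflect p) ^ 2 - aw_q (aw_reflect p) ^ (-2)) * chi^-1 * alpha
    * aw_b (aw_reflect p) * aw_q (aw_reflect p) ^ (- m0) = -1.
  by rewrite /= !exprz_inv !opprK -halpha -opprB !mulNr.
rewrite (ket_bethe_minus (aw_generic_reflect hgen) hkets hirr' (aw_relations_reflect hgen hrel) hA'
  chi0 halpha' (bethe_solution_reflect hgen sol_w)).
congr (_ *: _).
  apply: eq_bigr => i _; rewrite Astar_coef_reflect // /= exprz_inv -[(w i) ^ (-2)]invr_expz b_funV.
  by congr (_ * _)^-1; rewrite mulrN !mulNr.
rewrite /bethe_vector; elim: (enum _) => //= i l ->.
by rewrite /scrB_minus /scrB_plus calB_reflect //= exprz_inv opprD.
Qed.

Theorem lemma3p5 (R : realType) (p : aw_params (complex R))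
    (V : vectType (complex R)) (A As : 'End(V))
    (ket kets : 'I_(aw_2s p).+1 -> V)
    (chi alpham alphap : complex R) (m0 : int)
    (hgen : aw_generic p)
    (hLP : aw_leonard_pair p A As ket kets)
    (hchi : chi != 0)
    (halpham : (aw_q p ^ 2 - aw_q p ^ (-2)) * chi^-1 * alpham
                 * aw_b p * aw_q p ^ (- m0) = -1)
    (halphap : (aw_q p ^ 2 - aw_q p ^ (-2)) * chi^-1 * alphap
                 * aw_cs p * aw_q p ^ m0 = 1)
    (hSminus : forall M : 'I_(aw_2s p).+1,
       exists u : 'I_M -> complex R, bethe_solution p (-1) u)
    (hSplus : forall N : 'I_(aw_2s p).+1,
       exists w : 'I_N -> complex R, bethe_solution p 1 w) :
  (forall (M : 'I_(aw_2s p).+1) (u : 'I_M -> complex R),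
     bethe_solution p (-1) u ->
     ket M = norm_minus p u *:
       bethe_vector (scrB_minus p A As chi alpham) (ket ord0) m0 u)
  /\
  (forall (N : 'I_(aw_2s p).+1) (w : 'I_N -> complex R),
     bethe_solution p 1 w ->
     kets N = norm_plus p w *:
       bethe_vector (scrB_plus p A As chi alphap) (kets ord0) m0 w).
Proof.
have [_ hket hkets hirr hrel hAs hA _] := hLP.
split; first exact: ket_bethe_minus.
exact: kets_bethe_plus.
Qed.
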